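(* Fix an integer $n\ge 1$. For each $\delta\in\{3,5,7,9,11\}$, perfect linear flag-rank-metric codes in $\mathrm{U}(n,\mathbb{F}_q)$ with minimum distance $\delta$ do not exist for all sufficiently large prime powers $q$; that is, there is $q_0=q_0(n,\delta)$ such that for every prime power $q\ge q_0$ there is no perfect linear flag-rank-metric code in $\mathrm{U}(n,\mathbb{F}_q)$ with minimum distance $\delta$.
   Context: $\mathbb{F}_q$ is the finite field with $q$ elements. $\mathrm{U}(n,\mathbb{F}_q)$ is the $\mathbb{F}_q$-vector space of $n\times n$ upper triangular matrices over $\mathbb{F}_q$. For $M\in \mathrm{U}(n,\mathbb{F}_q)$ and $1\le i\le n$, $M_{[i]}$ is the $i\times(n-i+1)$ submatrix of $M$ obtained by deleting the first $i-1$ columns and the last $n-i$ rows (i.e. rows $1,\dots,i$ and columns $i,\dots,n$). The flag-rank weight of $M$ is $\mathrm{fr}(M)=\sum_{i=1}^{n}\mathrm{rk}(M_{[i]})$; the flag-rank distance is $\mathrm{d}_{\mathrm{fr}}(A,B)=\mathrm{fr}(A-B)$. A linear flag-rank-metric code is an $\mathbb{F}_q$-subspace $\mathcal{C}$ of $\mathrm{U}(n,\mathbb{F}_q)$; its minimum (flag-rank) distance, defined when $\mathcal{C}\neq\{\boldsymbol{0}\}$, is $\delta=\min\{\mathrm{fr}(M):M\in\mathcal{C}\setminus\{\boldsymbol{0}\}\}$. Let $b_q(n,t)=|\{A\in \mathrm{U}(n,\mathbb{F}_q):\mathrm{fr}(A)\le t\}|$. A code $\mathcal{C}$ with minimum distance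 $\delta$ is perfect if $|\mathcal{C}|\,b_q(n,t)=q^{\frac{n(n+1)}{2}}$, where $t=\left\lfloor\frac{\delta-1}{2}\right\rfloor$. *)

(* Defs.v *)
From mathcomp Require Import all_boot all_order all_algebra.

Set Implicit Arguments.
Unset Strict Implicit.
Unset Printing Implicit Defensive.

Local Open Scope ring_scope.

(* is_trig_mx is lower triangularity. *)
Definition is_triu_mx (F : finFieldType) (n : nat) (M : 'M[F]_n) : bool :=
  is_trig_mx M^T.

Fact flag_row_proof (n : nat) (i : 'I_n) (k : 'I_i.+1) : (k < n)%N.
Proof. exact: leq_trans (ltn_ord k) (ltn_ord i). Qed.

Fact flag_col_proof (n : nat) (i : 'I_n) (k : 'I_(n - i)) : (i + k < n)%N.
Proof. by rewrite -ltn_subRL. Qed.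

(* Indices start at 0, so flag_block M i consists of rows 0, ..., i and columns
   i, ..., n - 1 of M: it is the block M_[i + 1] of the 1-based convention. *)
Definition flag_block (F : finFieldType) (n : nat) (M : 'M[F]_n) (i : 'I_n) :
    'M[F]_(i.+1, n - i) :=
  mxsub (fun k => Ordinal (flag_row_proof k))
        (fun k => Ordinal (flag_col_proof k)) M.

Definition flag_rank (F : finFieldType) (n : nat) (M : 'M[F]_n) : nat :=
  (\sum_(i < n) \rank (flag_block M i))%N.

Definition flag_rank_dist (F : finFieldType) (n : nat) (A B : 'M[F]_n) : nat :=
  flag_rank (A - B).

Definition linear_flag_rank_code (F : finFieldType) (n : nat)
    (C : {vspace 'M[F]_n}) : Prop :=
  forall M, M \in C -> is_triu_mx M.

(* A relation: it holds for no delta when C = 0, where the minimum distance is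
   undefined. *)
Definition min_flag_rank_distance (F : finFieldType) (n : nat)
    (C : {vspace 'M[F]_n}) (delta : nat) : Prop :=
  (exists M, [/\ M \in C, M != 0 & flag_rank M = delta]) /\
  (forall M, M \in C -> M != 0 -> (delta <= flag_rank M)%N).

Definition flag_rank_ball_size (F : finFieldType) (n t : nat) : nat :=
  #|[set A : 'M[F]_n | is_triu_mx A & (flag_rank A <= t)%N]|.

Definition perfect_flag_rank_code (F : finFieldType) (n : nat)
    (C : {vspace 'M[F]_n}) (delta : nat) : Prop :=
  (#|[set M | M \in C]| * flag_rank_ball_size F n ((delta - 1) %/ 2)
   = #|F| ^ (n * (n + 1) %/ 2))%N.

(* Main.v *)
Require Import Defs.
From mathcomp Require Import all_boot all_order all_algebra.
From mathcomp Require Import finfield zify.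

(* If t < n, the number of matrices in the ball of radius t is not divisible by
   q once q > binom(n - 1, t), whereas for a perfect code it is a power of q
   greater than 1.  Adding a multiple of row l to row l + 1 (and discarding what
   falls below the diagonal) preserves the flag-rank, and an orbit of this
   action of the additive group of F_q has either one or q elements.  Taking
   l = 0, 1, ... in turn leaves, modulo q, only the diagonal matrices with at
   most t nonzero entries, of which there are
   \sum_(i <= t) binom(n, i) (q - 1)^i = (-1)^t binom(n - 1, t) modulo q.
   If n <= t <= 5, no matrix has flag-rank 2 t + 1. *)

Set Implicit Arguments.
Unset Strict Implicit.
Unset Printing Implicit Defensive.

Import GRing.Theory.
Local Open Scope ring_scope.

(** As [f] is constant along each line [M + c *: f M], these lines are the orbits of an action of
    the additive group of [F]. Where [f M] is nonzero, distinct scalars [c] give distinct points, so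
    each orbit has exactly [#|F|] elements. *)
Lemma card_dvd_translation_orbits (F : finFieldType) (m n : nat)
    (f : 'M[F]_(m, n) -> 'M[F]_(m, n)) (S : {set 'M[F]_(m, n)}) :
    (forall c M, f (M + c *: f M) = f M) ->
    (forall c M, M \in S -> M + c *: f M \in S) ->
  (#|F| %| #|[set M in S | f M != 0%R]|)%N.
Proof.
move=> fK Sf; set T := [set _ in S | _].
pose e (M N : 'M[F]_(m, n)) := [exists c : F, N == M + c *: f M].
have eP M c : e M (M + c *: f M) by apply/existsP; exists c.
have e_equiv : {in T & &, equivalence_rel e}.
  move=> M N P _ _ _; split; first by have := eP P 0; rewrite scale0r addr0.
  case/existsP=> c /eqP->; apply/idP/idP => /existsP[d /eqP->]; apply/existsP.
    by exists (d - c); rewrite fK -addrA -scalerDl addrCA subrr addr0.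
  by exists (c + d); rewrite fK -addrA -scalerDl.
rewrite (card_uniform_partition (n := #|F|) _ (equivalence_partitionP e_equiv)).
  exact: dvdn_mull.
move=> _ /imsetP[M /[!inE] /andP[SM fM0] ->].
rewrite -(@card_imset _ _ (fun c => M + c *: f M)).
  apply: eq_card => N; rewrite !inE; apply/idP/imsetP => [|[c _ ->]].
    by case/andP=> _ /existsP[c /eqP->]; exists c.
  by rewrite Sf // fK fM0 eP.
move=> c d /addrI /eqP; rewrite -subr_eq0 -scalerBl scaler_eq0 (negPf fM0) orbF.
by rewrite subr_eq0 => /eqP.
Qed.

(** The condition [l < j] keeps exactly the entries that land on or above the diagonal in row
    [l.+1]. For the last row [l] the result is 0. *)
Definition shift_row (F : finFieldType) (n : nat) (l : 'I_n) (M : 'M[F]_n) :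
    'M[F]_n :=
  \matrix_(i, j) if (i == l.+1 :> nat) && (l < j)%N then M l j else 0.

Lemma shift_row_idem (F : finFieldType) (n : nat) (l : 'I_n) (c : F) M :
  shift_row l (M + c *: shift_row l M) = shift_row l M.
Proof.
apply/matrixP=> i j; rewrite !mxE; case: ifP => // _.
by rewrite ltn_eqF //= mulr0 addr0.
Qed.

Lemma shift_row_eq0 (F : finFieldType) (n : nat) (l : 'I_n) (M : 'M[F]_n) :
  (shift_row l M == 0) = [forall j : 'I_n, (l < j)%N ==> (M l j == 0)].
Proof.
apply/eqP/forallP => [/matrixP f0 j|M0].
  apply/implyP => lj; have Hl : (l.+1 < n)%N := leq_ltn_trans lj (ltn_ord j).
  by have := f0 (Ordinal Hl) j; rewrite !mxE eqxx lj /= => ->.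
apply/matrixP=> i j; rewrite !mxE; case: ifP => // /andP[_ lj].
exact/eqP/(implyP (M0 j)).
Qed.

Lemma triuP (F : finFieldType) (n : nat) (M : 'M[F]_n) :
  reflect (forall i j : 'I_n, (j < i)%N -> M i j = 0) (is_triu_mx M).
Proof.
apply: (iffP is_trig_mxP) => M0 i j ij; first by rewrite -(M0 j i ij) mxE.
by rewrite mxE M0.
Qed.

Lemma is_triu_shift_row (F : finFieldType) (n : nat) (l : 'I_n) (c : F) M :
  is_triu_mx M -> is_triu_mx (M + c *: shift_row l M).
Proof.
move=> /triuP M0; apply/triuP => i j ji; rewrite !mxE (M0 i j ji) add0r.
case: ifP => [/andP[/eqP il lj]|]; last by rewrite mulr0.
by move: ji; rewrite il ltnS leqNgt lj.
Qed.

(** A block containing row [l.+1] also contains row [l], and all its columns lie to the right of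
    [l], so the truncation is invisible there: the block undergoes a true row operation and its row
    space cannot grow. *)
Lemma flag_rank_shift_row (F : finFieldType) (n : nat) (l : 'I_n) (c : F) M :
  (flag_rank (M + c *: shift_row l M) <= flag_rank M)%N.
Proof.
apply: leq_sum => i _; apply/mxrankS/row_subP => k.
have [kl|kl] := eqVneq (k : nat) l.+1.
  have li : (l < i.+1)%N by apply: leq_trans (ltn_ord k); rewrite kl.
  suff -> : row k (flag_block (M + c *: shift_row l M) i) =
            row k (flag_block M i) + c *: row (Ordinal li) (flag_block M i).
    by rewrite addmx_sub ?scalemx_sub ?row_sub.
  apply/rowP=> j; rewrite !mxE /= (introT eqP kl) /=.
  have -> : (l < i + j)%N by have := ltn_ord k; lia.
  by congr (_ + _ * M _ _); apply: val_inj.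
suff -> : row k (flag_block (M + c *: shift_row l M) i) =
          row k (flag_block M i).
  exact: row_sub.
by apply/rowP=> j; rewrite !mxE /= (negPf kl) mulr0 addr0.
Qed.

(** Interpolates between the whole ball ([m = 0]) and its diagonal matrices ([m = n]). *)
Definition partial_diag_ball (F : finFieldType) (n t m : nat) : {set 'M[F]_n} :=
  [set A | [&& is_triu_mx A, (flag_rank A <= t)%N &
     [forall i : 'I_n, (i < m)%N ==>
        [forall j : 'I_n, (i < j)%N ==> (A i j == 0)]]]].

Lemma card_partial_diag_ballS (F : finFieldType) (n t : nat) (l : 'I_n) :
  #|partial_diag_ball F n t l| =
  #|partial_diag_ball F n t l.+1| %[mod #|F|].
Proof.
set S := partial_diag_ball F n t l.
(* The fixed points of the action on [S] form the next set; the rest splits into orbits of size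
   [#|F|]. The action stays inside [S] since it only alters row [l.+1], while [S] constrains the
   rows before [l]. *)
have SE : partial_diag_ball F n t l.+1 = [set M in S | shift_row l M == 0].
  apply/setP=> M; rewrite !inE shift_row_eq0 -!andbA; do 2!congr (_ && _).
  apply/forallP/andP => [M0|[/forallP M0 Ml] i].
    split; last exact: (implyP (M0 l)).
    apply/forallP=> i; apply/implyP=> il.
    exact: (implyP (M0 i) (ltnW il)).
  apply/implyP; rewrite ltnS leq_eqVlt => /orP[/eqP/val_inj -> //|].
  exact/implyP.
have q_dvd : (#|F| %| #|[set M in S | shift_row l M != 0%R]|)%N.
  apply: card_dvd_translation_orbits => [|c M]; first exact: shift_row_idem.
  rewrite !inE => /and3P[triuM frM /forallP M0]; apply/and3P; split.
  - exact: is_triu_shift_row.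
  - exact: leq_trans (flag_rank_shift_row l c M) frM.
  apply/forallP=> i; apply/implyP=> il; have /forallP M0i := implyP (M0 i) il.
  apply/forallP=> j; apply/implyP=> ij; rewrite !mxE (eqP (implyP (M0i j) ij)).
  by rewrite ltn_eqF ?mulr0 ?addr0 // ltnS ltnW.
rewrite -(cardsID [set M | shift_row l M == 0] S) SE -modnDmr.
have -> : S :\: [set M | shift_row l M == 0] =
          [set M in S | shift_row l M != 0].
  by apply/setP=> M; rewrite !inE andbC.
rewrite (eqP q_dvd) addn0; congr (#|pred_of_set _| %% _)%N.
by apply/setP=> M; rewrite !inE.
Qed.

Lemma flag_rank_ball_size_mod (F : finFieldType) (n t : nat) :
  flag_rank_ball_size F n t = #|partial_diag_ball F n t n| %[mod #|F|].
Proof.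
suff H m : (m <= n)%N ->
    flag_rank_ball_size F n t = #|partial_diag_ball F n t m| %[mod #|F|].
  exact: H.
elim: m => [_|m IHm ltmn].
  congr (#|pred_of_set _| %% _)%N; apply/setP=> M; rewrite !inE; congr andb.
  by rewrite (_ : [forall i, _]) ?andbT //; apply/forallP.
by rewrite IHm ?(card_partial_diag_ballS F t (Ordinal ltmn)) // ltnW.
Qed.

Lemma flag_rank_diag_mx (F : finFieldType) (n : nat) (d : 'rV[F]_n) :
  flag_rank (diag_mx d) = #|[set i | d 0 i != 0]|.
Proof.
rewrite -sum1dep_card big_mkcond; apply: eq_bigr => i _.
have ni : (0 < n - i)%N by rewrite subn_gt0.
(* The block meets the diagonal only in its bottom left corner. *)
have -> : flag_block (diag_mx d) i = d 0 i *: delta_mx ord_max (Ordinal ni).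
  apply/matrixP=> k j; rewrite !mxE -!val_eqE /=.
  have [/eqP kj|kj] := boolP (_ == _ :> nat).
    have ki : (k : nat) = i by have := ltn_ord k; lia.
    have j0 : (j : nat) = 0%N by lia.
    rewrite (introT eqP ki) (introT eqP j0) mulr1n mulr1; congr (d _ _).
    exact: val_inj.
  rewrite mulr0n; have -> : (k == i :> nat) && (j == 0 :> nat) = false by lia.
  by rewrite mulr0.
case: ifP => [di|/negbFE/eqP->]; last by rewrite scale0r mxrank0.
by rewrite mxrank_scale_nz ?mxrank_delta.
Qed.

Lemma is_triu_diag_mx (F : finFieldType) (n : nat) (d : 'rV[F]_n) :
  is_triu_mx (diag_mx d).
Proof. by apply/triuP=> i j ji; rewrite mxE -val_eqE gtn_eqF. Qed.

Lemma card_diag_ball (F : finFieldType) (n t : nat) :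
  #|partial_diag_ball F n t n| =
  (\sum_(i < t.+1) 'C(n, i) * (#|F| - 1) ^ i)%N.
Proof.
pose W := [set d : {ffun 'I_n -> F} | #|[set i | d i != 0%R]| <= t]%N.
pose D (d : {ffun 'I_n -> F}) := diag_mx (\row_i d i).
have D_inj : injective D.
  move=> d e /matrixP de; apply/ffunP=> i.
  by have := de i i; rewrite !mxE eqxx.
have -> : partial_diag_ball F n t n = D @: W.
  apply/setP=> M; rewrite inE; apply/and3P/imsetP => [[triuM frM M0]|[d dW ->]].
    have MD : M = D [ffun i => M i i].
      apply/matrixP=> i j; rewrite !mxE ffunE.
      case: (ltngtP i j) => [ij|ji|/val_inj->]; last by rewrite eqxx.
      - rewrite -val_eqE ltn_eqF //; apply/eqP.
        by have /implyP/(_ (ltn_ord i))/forallP/(_ j)/implyP-> := forallP M0 i.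
      by rewrite -val_eqE gtn_eqF // (triuP _ triuM).
    exists [ffun i => M i i] => //; move: frM.
    rewrite {1}MD flag_rank_diag_mx inE => frM; apply: leq_trans frM.
    by apply: subset_leq_card; apply/subsetP=> i; rewrite !inE mxE.
  split; first exact: is_triu_diag_mx.
    rewrite flag_rank_diag_mx; move: dW; rewrite inE; apply: leq_trans.
    by apply: subset_leq_card; apply/subsetP=> i; rewrite !inE mxE.
  apply/forallP=> i; apply/implyP=> _; apply/forallP=> j; apply/implyP=> ij.
  by rewrite mxE -val_eqE ltn_eqF.
rewrite card_imset // -sum1dep_card.
pose supp (d : {ffun 'I_n -> F}) := [set i | d i != 0%R].
rewrite (partition_big supp (fun A => #|A| <= t)%N) //=.
have fiber (A : {set 'I_n}) : (#|A| <= t)%N ->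
    (\sum_(d : {ffun 'I_n -> F} |
           (#|[set i | d i != 0%R]| <= t)%N && (supp d == A)) 1 =
     (#|F| - 1) ^ #|A|)%N.
  move=> At; rewrite sum1dep_card subn1 -(cardC1 (0 : F)).
  (* The fiber over [A] consists of the maps from [A] to the nonzero scalars, extended by 0. *)
  rewrite -(card_pffun_on 0 A); apply: eq_card => d; rewrite !inE.
  rewrite /supp; apply/andP/pffun_onP => [[_ /eqP<-]|[dA d0]].
    split; first by apply/subsetP=> i; rewrite !inE.
    by move=> i /imageP[j]; rewrite !inE => dj ->.
  have -> : [set i | d i != 0] = A.
    apply/setP=> i; rewrite inE; apply/idP/idP => [|iA].
      exact: (subsetP dA i).
    by apply: d0; apply: image_f.
  by rewrite eqxx.
rewrite (eq_bigr _ fiber).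
(* Supports are grouped by size; [inord] is faithful here because [#|A| <= t]. *)
rewrite (partition_big (fun A : {set 'I_n} => inord #|A|)
                       (fun _ : 'I_t.+1 => true)) //.
apply: eq_bigr => i _.
rewrite -[n in 'C(n, _)]card_ord -card_draws -sum1dep_card.
rewrite big_distrl /=; apply: eq_big => [A|A].
  apply/andP/eqP => [[At /eqP<-]|Ai]; first by rewrite inordK.
  by rewrite Ai -ltnS ltn_ord inord_val.
by case/andP=> At /eqP<-; rewrite mul1n inordK.
Qed.

(** By Pascal's rule. For [x = q - 1] the first summand is a multiple of [q], which isolates the
    residue without signed integers. *)
Lemma sum_bin_expn (n t x : nat) :
  (\sum_(i < t.+1) 'C(n.+1, i) * x ^ i =
   x.+1 * (\sum_(i < t) 'C(n, i) * x ^ i) + 'C(n, t) * x ^ t)%N.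
Proof.
elim: t => [|t IHt]; first by rewrite big_ord_recr !big_ord0 /= !bin0 muln0.
by rewrite big_ord_recr /= IHt big_ord_recr /= binS expnS; lia.
Qed.

Lemma flag_rank_ball_size_ndvd (F : finFieldType) (n t : nat) :
  (t <= n)%N -> ('C(n, t) < #|F|)%N ->
  ~~ (#|F| %| flag_rank_ball_size F n.+1 t)%N.
Proof.
move=> tn Fbig.
rewrite /dvdn flag_rank_ball_size_mod card_diag_ball sum_bin_expn.
have F_gt0 : (0 < #|F|)%N by apply: leq_trans Fbig.
rewrite -[(_ == _)]/(dvdn _ _) subn1 prednK // dvdn_addr; last exact: dvdn_mulr.
(* As [q] is coprime to [q - 1], it would have to divide the binomial coefficient, which is positive
   and less than [q]. *)
rewrite Gauss_dvdl; last by rewrite coprimeXr // coprimenP.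
by apply: contraL Fbig => /dvdn_leq; rewrite -leqNgt; apply; rewrite bin_gt0.
Qed.

(** The [#|F|] matrices supported on the top left corner have flag-rank at most 1. *)
Lemma flag_rank_ball_size_gt1 (F : finFieldType) (n t : nat) :
  (0 < t)%N -> (1 < flag_rank_ball_size F n.+1 t)%N.
Proof.
move=> t_gt0; pose A (c : F) : 'M[F]_n.+1 := diag_mx (c *: delta_mx 0 0).
have A_inj : injective A.
  by move=> c d /matrixP/(_ 0 0); rewrite !mxE /= !mulr1.
apply: leq_trans (card_finNzRing_gt1 F) _; rewrite -(card_imset _ A_inj).
apply/subset_leq_card/subsetP => _ /imsetP[c _ ->].
rewrite inE is_triu_diag_mx flag_rank_diag_mx (leq_trans _ t_gt0) //.
apply: (leq_trans _ (eq_leq (cards1 (0 : 'I_n.+1)))).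
apply/subset_leq_card/subsetP => i.
by rewrite !inE !mxE; apply: contraR => /negPf->; rewrite mulr0.
Qed.

Lemma flag_rank_leq (F : finFieldType) (n : nat) (M : 'M[F]_n) :
  (flag_rank M <= \sum_(i < n) minn i.+1 (n - i))%N.
Proof.
by apply: leq_sum => i _; rewrite leq_min rank_leq_row rank_leq_col.
Qed.

Theorem corollary5p17 (n delta : nat) (hn : (1 <= n)%N)
    (hdelta : delta \in [:: 3; 5; 7; 9; 11]%N) :
  exists q0 : nat, forall F : finFieldType, (q0 <= #|F|)%N ->
    ~ exists C : {vspace 'M[F]_n},
        [/\ linear_flag_rank_code C,
            min_flag_rank_distance C delta
          & perfect_flag_rank_code C delta].
Proof.
have [t t_bnd deltaE] : exists2 t, (0 < t <= 5)%N & delta = (2 * t).+1.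
  exists delta./2; move: hdelta; rewrite !inE; by do 4?[case/orP]; move/eqP->.
(* From here on the matrices have size [n.+1]. *)
case: n hn => // n _; exists 'C(n, t).+1 => F Fbig [C [_ [[M [_ _ frM]] _]]].
rewrite /perfect_flag_rank_code (_ : (delta - 1) %/ 2 = t)%N; last by lia.
have tn : (t <= n)%N.
  (* Otherwise the size is at most [t <= 5]. For sizes 1 to 5 the flag-rank is at most 1, 2, 4, 6,
     9, always below [2 * t + 1]. *)
  rewrite leqNgt; apply/negP=> nt; have := flag_rank_leq M; rewrite frM deltaE.
  case: n nt {C M frM Fbig} => [|[|[|[|[|n]]]]] nt;
    by [lia | rewrite !big_ord_recl big_ord0 /= /bump; lia].
have := flag_rank_ball_size_ndvd tn Fbig.
have t_gt0 : (0 < t)%N by case/andP: t_bnd.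
have := flag_rank_ball_size_gt1 F n t_gt0.
have -> : #|[set M | M \in C]| = (#|F| ^ \dim C)%N.
  by rewrite -card_vspace cardsE.
move: (flag_rank_ball_size _ _ _) (_ %/ 2)%N => b N b_gt1 b_ndvd bN.
have q_gt1 := card_finNzRing_gt1 F; have q_gt0 := ltnW q_gt1.
have dimN : (\dim C <= N)%N.
  by rewrite -(leq_exp2l _ _ q_gt1) -bN leq_pmulr // ltnW.
(* Cancelling the size of [C] leaves the ball size [b] as a power of [q]: exponent 0 contradicts
   [b_gt1], a positive one [b_ndvd]. *)
move/eqP: bN; rewrite -(subnKC dimN) expnD eqn_pmul2l ?expn_gt0 ?q_gt0 //.
case: (N - \dim C)%N => [|k] /eqP bE; first by rewrite bE in b_gt1.
by rewrite bE expnS dvdn_mulr in b_ndvd.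
Qed.
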